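(* Let $T:V\to L$ be a relative Rota-Baxter operator on a (right) Leibniz algebra $(L,[\cdot,\cdot]_L)$ with respect to a representation $(V;\rho^l,\rho^r)$. Let $\phi_1,\phi_2\in Z^2_T(V,L)$ be $2$-cocycles of the Leibniz algebra $(V,[\cdot,\cdot]_T)$ with coefficients in $(L;\rho^l_T,\rho^r_T)$. If $\phi_1,\phi_2$ are in the same cohomology class, then $\omega_1,\omega_2$ defined by $\omega_i(u,v,w)=\phi_i([u,v]_T,w)+\rho^r_T(w)\phi_i(u,v)$, $i=1,2$, are in the same cohomology class of the associated Leibniz triple system $(V,\{\cdot,\cdot,\cdot\}_T=[[\cdot,\cdot]_T,\cdot]_T)$ with respect to the representation $(R_T,M_T,L_T)$ on $L$.
   Context: All vector spaces are over a fixed arbitrary field. A (right) Leibniz algebra is a vector space $L$ with a bilinear bracket satisfying $[x,[y,z]_L]_L=[[x,y]_L,z]_L-[[x,z]_L,y]_L$. A representation $(V;\rho^l,\rho^r)$ of $L$ consists of a vector space $V$ and linear maps $\rho^l,\rho^r:L\to\mathfrak{gl}(V)$ with, for all $x,y\in L$: $\rho^l([x,y]_L)=\rho^r(y)\rho^l(x)-\rho^l(x)\rho^r(y)$, $\rho^l([x,y]_L)=\rho^l(x)\rho^l(y)+\rho^r(y)\rho^l(x)$, $\rho^r([x,y]_L)=\rho^r(y)\rho^r(x)-\rho^r(x)\rho^r(y)$. A relative Rota-Baxter operator on $L$ with respect to $(V;\rho^l,\rho^r)$ is a linear map $T:V\to L$ with $[Tu,Tv]_L=T(\rho^l(Tu)v+\rho^r(Tv)u)$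 for all $u,v\in V$. Then $V$ is a Leibniz algebra with $[u,v]_T=\rho^l(Tu)v+\rho^r(Tv)u$, with a representation $(L;\rho^l_T,\rho^r_T)$ given by $\rho^l_T(u)x=[Tu,x]_L-T\rho^r(x)u$, $\rho^r_T(u)x=[x,Tu]_L-T\rho^l(x)u$ ($u\in V$, $x\in L$). $Z^2_T(V,L)$ is the space of bilinear maps $\phi:V\times V\to L$ such that for all $u,v,w\in V$: $\rho^l_T(u)\phi(v,w)-\rho^r_T(w)\phi(u,v)+\rho^r_T(v)\phi(u,w)+\phi(u,[v,w]_T)-\phi([u,v]_T,w)+\phi([u,w]_T,v)=0$. Two elements $\phi_1,\phi_2\in Z^2_T(V,L)$ are in the same cohomology class if $\phi_2-\phi_1=d_T\alpha$ for some linear map $\alpha:V\to L$, where $d_T\alpha(u,v)=\rho^l_T(u)\alpha(v)+\rho^r_T(v)\alpha(u)-\alpha([u,v]_T)$. $(V,\{\cdot,\cdot,\cdot\}_T)$ with $\{u,v,w\}_T=[[u,v]_T,w]_T$ is a Leibniz triple system, with representation $(R_T,M_T,L_T)$ on $L$, where $R_T(u,v)x=\rho^r_T(v)\rho^r_T(u)x$, $M_T(u,v)x=\rho^r_T(v)\rho^l_T(u)x$, $L_T(u,v)x=\rho^l_T([u,v]_T)x$. (A Leibniz triple system is a vector space with a trilinear product satisfying $\{a,b,\{c,d,e\}\}=\{\{a,b,c\},d,e\}-\{\{a,b,d\},c,e\}-\{\{a,b,e\},c,d\}+\{\{a,b,e\},d,c\}$ and $\{a,\{b,c,d\},e\}=\{\{a,b,c\},d,e\}-\{\{a,c,b\},d,e\}-\{\{a,d,b\},c,e\}+\{\{a,d,c\},b,e\}$;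 a triple $(r,m,l)$ of bilinear maps from it to $\mathrm{End}(W)$ is a representation on $W$ iff the direct sum with product $\{x+u,y+v,z+w\}=\{x,y,z\}+l(x,y)w+m(x,z)v+r(y,z)u$ is again a Leibniz triple system.) The maps $\omega_1,\omega_2$ are $3$-cocycles of this Leibniz triple system (i.e. annihilated by both of its $3$-coboundary operators). Two such $3$-cocycles are in the same cohomology class of the Leibniz triple system if $\omega_2-\omega_1=\partial^1\alpha$ for some linear map $\alpha:V\to L$, where $\partial^1\alpha(u,v,w)=R_T(v,w)\alpha(u)+M_T(u,w)\alpha(v)+L_T(u,v)\alpha(w)-\alpha(\{u,v,w\}_T)$. *)

(* Defs.v *)
From HB Require Import structures.
From mathcomp Require Import all_boot ssralg sesquilinear.

Set Implicit Arguments.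
Unset Strict Implicit.
Unset Printing Implicit Defensive.

Import GRing.Theory.
Local Open Scope ring_scope.

(* Vector spaces are arbitrary modules [lmodType K] over a field [K], with no
   finite-dimensionality assumption. A linear map L -> gl(V) is given in
   uncurried form, as a bilinear map L -> V -> V. *)

Lemma addr_cancelN (V : zmodType) (x r : V) : r = x -> - x + r = 0.
Proof. by move=> ->; rewrite addNr. Qed.

Lemma addr_cancelP (V : zmodType) (x r : V) : r = - x -> x + r = 0.
Proof. by move=> ->; rewrite addrN. Qed.

Lemma addr_cancel_head (V : zmodType) (x r : V) : r = 0 -> x + r = x.
Proof. by move=> ->; rewrite addr0. Qed.

(* Proves equations between sums that hold in any abelian group. *)
Ltac zmod_cancel :=
  apply/eqP; rewrite -subr_eq0; apply/eqP;
  rewrite ?(opprD, opprK, oppr0); rewrite -[LHS]addr0 -?addrA;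
  repeat (
    lazymatch goal with
    | |- 0 = 0 => reflexivity
    | |- 0 + ?r = 0 => rewrite add0r
    | |- - ?x + ?r = 0 => apply: addr_cancelN
    | |- ?x + ?r = 0 => apply: addr_cancelP
    end;
    repeat lazymatch goal with
    | |- ?x + ?r = ?x => apply: addr_cancel_head
    | |- _ = 0 => fail
    | |- _ = ?x => first [rewrite (addrCA _ x) | apply: addr_cancel_head]
    end).

Section Trilinear.
Variable K : fieldType.

Definition trilinear (U1 U2 U3 W : lmodType K) (f : U1 -> U2 -> U3 -> W) :=
  [/\ forall b c, linear (fun a => f a b c),
      forall a c, linear (fun b => f a b c)
    & forall a b, linear (fun c => f a b c)].

End Trilinear.

Section LeibnizAlgebras.
Variable K : fieldType.

Record leibnizAlgebra (L : lmodType K) := LeibnizAlgebra {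
  leib_bracket :> {bilinear L -> L -> L};
  leib_identity : forall x y z,
    leib_bracket x (leib_bracket y z)
    = leib_bracket (leib_bracket x y) z - leib_bracket (leib_bracket x z) y
}.

Record leibnizRep (L : lmodType K) (A : leibnizAlgebra L) (V : lmodType K) :=
  LeibnizRep {
  rep_l : {bilinear L -> V -> V};
  rep_r : {bilinear L -> V -> V};
  rep_l_r : forall x y v,
    rep_l (A x y) v = rep_r y (rep_l x v) - rep_l x (rep_r y v);
  rep_l_l : forall x y v,
    rep_l (A x y) v = rep_l x (rep_l y v) + rep_r y (rep_l x v);
  rep_r_r : forall x y v,
    rep_r (A x y) v = rep_r y (rep_r x v) - rep_r x (rep_r y v)
}.

Variables (L V : lmodType K) (A : leibnizAlgebra L) (rho : leibnizRep A V).

Definition leib_d1 (alpha : L -> V) (x y : L) : V :=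
  rep_l rho x (alpha y) + rep_r rho y (alpha x) - alpha (A x y).

Definition leib_cocycle2 (phi : {bilinear L -> L -> V}) : Prop :=
  forall x y z,
    rep_l rho x (phi y z) - rep_r rho z (phi x y) + rep_r rho y (phi x z)
    + phi x (A y z) - phi (A x y) z + phi (A x z) y = 0.

Definition leib_cohomologous2 (phi1 phi2 : {bilinear L -> L -> V}) : Prop :=
  [/\ leib_cocycle2 phi1, leib_cocycle2 phi2
    & exists alpha : {linear L -> V},
        forall x y, phi2 x y - phi1 x y = leib_d1 alpha x y].

Record relRotaBaxter := RelRotaBaxter {
  rb_map :> {linear V -> L};
  rb_identity : forall u v,
    A (rb_map u) (rb_map v)
    = rb_map (rep_l rho (rb_map u) v + rep_r rho (rb_map v) u)
}.

End LeibnizAlgebras.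

Section InducedByRotaBaxter.
Variables (K : fieldType) (L V : lmodType K) (A : leibnizAlgebra L).
Variables (rho : leibnizRep A V) (T : relRotaBaxter rho).

Let linE := (linearDl, linearDr, linearNl, linearNr, linearD T, linearN T).

Definition rb_bracket (u v : V) : V :=
  rep_l rho (T u) v + rep_r rho (T v) u.

Definition rb_rep_l (u : V) (x : L) : L := A (T u) x - T (rep_r rho x u).

Definition rb_rep_r (u : V) (x : L) : L := A x (T u) - T (rep_l rho x u).

Lemma rb_bracket_bilinear : bilinear_for
  (GRing.Scale.Law.clone _ _ *:%R _) (GRing.Scale.Law.clone _ _ *:%R _)
  rb_bracket.
Proof.
split=> [w|w] a x y; rewrite /rb_bracket !(linearP, linearPl) /= scalerDr;
  zmod_cancel.
Qed.

Lemma rb_rep_l_bilinear : bilinear_for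
  (GRing.Scale.Law.clone _ _ *:%R _) (GRing.Scale.Law.clone _ _ *:%R _)
  rb_rep_l.
Proof.
split=> [w|w] a x y; rewrite /rb_rep_l !(linearP, linearPl) /= !(scalerDr, scalerN);
  zmod_cancel.
Qed.

Lemma rb_rep_r_bilinear : bilinear_for
  (GRing.Scale.Law.clone _ _ *:%R _) (GRing.Scale.Law.clone _ _ *:%R _)
  rb_rep_r.
Proof.
split=> [w|w] a x y; rewrite /rb_rep_r !(linearP, linearPl) /= !(scalerDr, scalerN);
  zmod_cancel.
Qed.

HB.instance Definition _ :=
  bilinear_isBilinear.Build K V V V _ _ rb_bracket rb_bracket_bilinear.
HB.instance Definition _ :=
  bilinear_isBilinear.Build K V L L _ _ rb_rep_l rb_rep_l_bilinear.
HB.instance Definition _ :=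
  bilinear_isBilinear.Build K V L L _ _ rb_rep_r rb_rep_r_bilinear.

Lemma rb_bracket_morph u v : T (rb_bracket u v) = A (T u) (T v).
Proof. by rewrite rb_identity. Qed.

Lemma rb_bracket_leibniz u v w :
  rb_bracket u (rb_bracket v w)
  = rb_bracket (rb_bracket u v) w - rb_bracket (rb_bracket u w) v.
Proof.
rewrite {1 3 5}/rb_bracket !rb_bracket_morph rep_r_r (rep_l_l _ (T u) (T v)).
rewrite (rep_l_r _ (T u) (T w)) /rb_bracket !linE; zmod_cancel.
Qed.

Definition rb_leibniz : leibnizAlgebra V :=
  LeibnizAlgebra rb_bracket_leibniz.

Lemma rb_rep_l_r u v x :
  rb_rep_l (rb_leibniz u v) x
  = rb_rep_r v (rb_rep_l u x) - rb_rep_l u (rb_rep_r v x).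
Proof.
rewrite /= /rb_rep_l /rb_rep_r rb_bracket_morph /rb_bracket !linE.
rewrite leib_identity !rb_identity !linE rep_l_l rep_r_r !linE; zmod_cancel.
Qed.

Lemma rb_rep_l_l u v x :
  rb_rep_l (rb_leibniz u v) x
  = rb_rep_l u (rb_rep_l v x) + rb_rep_r v (rb_rep_l u x).
Proof.
rewrite /= /rb_rep_l /rb_rep_r rb_bracket_morph /rb_bracket !linE.
rewrite leib_identity !rb_identity !linE rep_l_r rep_r_r !linE; zmod_cancel.
Qed.

Lemma rb_rep_r_r u v x :
  rb_rep_r (rb_leibniz u v) x
  = rb_rep_r v (rb_rep_r u x) - rb_rep_r u (rb_rep_r v x).
Proof.
rewrite /= /rb_rep_l /rb_rep_r rb_bracket_morph /rb_bracket !linE.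
rewrite leib_identity !rb_identity !linE 
  (rep_l_l _ x (T u)) (rep_l_r _ x (T v)) !linE; zmod_cancel.
Qed.

Definition rb_rep : leibnizRep rb_leibniz L :=
  LeibnizRep rb_rep_l_r rb_rep_l_l rb_rep_r_r.

End InducedByRotaBaxter.

Section LeibnizTripleSystems.
Variable K : fieldType.

Definition is_lts (U : lmodType K) (t : U -> U -> U -> U) : Prop :=
  [/\ trilinear t,
      forall a b c d e,
        t a b (t c d e)
        = t (t a b c) d e - t (t a b d) c e - t (t a b e) c d + t (t a b e) d c
    & forall a b c d e,
        t a (t b c d) e
        = t (t a b c) d e - t (t a c b) d e - t (t a d b) c e
          + t (t a d c) b e].

Record leibnizTriple (U : lmodType K) := LeibnizTriple {
  lts_op :> U -> U -> U -> U;
  lts_opP : is_lts lts_op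
}.

(* A bilinear map U * U -> End(W) is given in uncurried form, as a trilinear
   map U -> U -> W -> W. *)
Definition lts_semidirect (U W : lmodType K) (t : U -> U -> U -> U)
    (r m l : U -> U -> W -> W) (a b c : U * W) : U * W :=
  (t a.1 b.1 c.1, l a.1 b.1 c.2 + m a.1 c.1 b.2 + r b.1 c.1 a.2).

Record ltsRep (U : lmodType K) (t : leibnizTriple U) (W : lmodType K) :=
  LtsRep {
  lts_r : U -> U -> W -> W;
  lts_m : U -> U -> W -> W;
  lts_l : U -> U -> W -> W;
  lts_r_trilinear : trilinear lts_r;
  lts_m_trilinear : trilinear lts_m;
  lts_l_trilinear : trilinear lts_l;
  lts_semidirectP : is_lts (lts_semidirect t lts_r lts_m lts_l)
}.

Variables (U W : lmodType K) (t : leibnizTriple U) (theta : ltsRep t W).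

Local Notation R := (lts_r theta).
Local Notation M := (lts_m theta).
Local Notation L := (lts_l theta).

Definition lts_d1 (alpha : U -> W) (u v w : U) : W :=
  R v w (alpha u) + M u w (alpha v) + L u v (alpha w) - alpha (t u v w).

(* The two 3-coboundary operators are the linearizations of the two defining
   identities: for trilinear omega, both vanish exactly when the product
   {x+u, y+v, z+w} = {x,y,z} + omega(x,y,z) + l(x,y)w + m(x,z)v + r(y,z)u
   on the direct sum is a Leibniz triple system; see [lts_cocycle3P]. *)
Definition lts_d3_1 (omega : U -> U -> U -> W) (a b c d e : U) : W :=
  L a b (omega c d e) + omega a b (t c d e)
  - (R d e (omega a b c) + omega (t a b c) d e)
  + (R c e (omega a b d) + omega (t a b d) c e)
  + (R c d (omega a b e) + omega (t a b e) c d)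
  - (R d c (omega a b e) + omega (t a b e) d c).

Definition lts_d3_2 (omega : U -> U -> U -> W) (a b c d e : U) : W :=
  M a e (omega b c d) + omega a (t b c d) e
  - (R d e (omega a b c) + omega (t a b c) d e)
  + (R d e (omega a c b) + omega (t a c b) d e)
  + (R c e (omega a d b) + omega (t a d b) c e)
  - (R b e (omega a d c) + omega (t a d c) b e).

Definition lts_cocycle3 (omega : U -> U -> U -> W) : Prop :=
  [/\ trilinear omega,
      forall a b c d e, lts_d3_1 omega a b c d e = 0
    & forall a b c d e, lts_d3_2 omega a b c d e = 0].

Definition lts_cohomologous3 (omega1 omega2 : U -> U -> U -> W) : Prop :=
  [/\ lts_cocycle3 omega1, lts_cocycle3 omega2
    & exists alpha : {linear U -> W},
        forall u v w, omega2 u v w - omega1 u v w = lts_d1 alpha u v w].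

Definition lts_twisted (omega : U -> U -> U -> W) (a b c : U * W) : U * W :=
  (t a.1 b.1 c.1,
   omega a.1 b.1 c.1 + (L a.1 b.1 c.2 + M a.1 c.1 b.2 + R b.1 c.1 a.2)).

Lemma trilinearD (U1 U2 U3 X : lmodType K) (f : U1 -> U2 -> U3 -> X) :
  trilinear f ->
  [/\ forall a a' b c, f (a + a') b c = f a b c + f a' b c,
      forall a b b' c, f a (b + b') c = f a b c + f a b' c
    & forall a b c c', f a b (c + c') = f a b c + f a b c'].
Proof.
case=> f1 f2 f3; split=> [a a' b c|a b b' c|a b c c'].
- by have := f1 b c 1 a a'; rewrite !scale1r.
- by have := f2 a c 1 b b'; rewrite !scale1r.
- by have := f3 a b 1 c c'; rewrite !scale1r.
Qed.

Lemma trilinear0 (U1 U2 U3 X : lmodType K) (f : U1 -> U2 -> U3 -> X) :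
  trilinear f ->
  [/\ forall b c, f 0 b c = 0, forall a c, f a 0 c = 0
    & forall a b, f a b 0 = 0].
Proof.
move=> /trilinearD[f1 f2 f3]; split=> a b.
- by apply: (addrI (f 0 a b)); rewrite -f1 !addr0.
- by apply: (addrI (f a 0 b)); rewrite -f2 !addr0.
- by apply: (addrI (f a b 0)); rewrite -f3 !addr0.
Qed.

Lemma lts_cocycle3P (omega : U -> U -> U -> W) : trilinear omega ->
  is_lts (lts_twisted omega) <-> lts_cocycle3 omega.
Proof.
move=> omegaT; have [o1 o2 o3] := omegaT.
have [tT _ _] := lts_opP t; have [t01 t02 t03] := trilinear0 tT.
have [R1 R2 _] := trilinear0 (lts_r_trilinear theta).
have [M1 M2 _] := trilinear0 (lts_m_trilinear theta).
have [L1 L2 _] := trilinear0 (lts_l_trilinear theta).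
set S := lts_semidirect t R M L; pose i w : U * W := (0, w).
have iD v w : i (v + w) = i v + i w by congr pair; rewrite /= addr0.
have iN w : i (- w) = - i w by congr pair; rewrite /= oppr0.
have iZ k w : i (k *: w) = k *: i w by congr pair; rewrite /= scaler0.
have twE a b c : lts_twisted omega a b c = S a b c + i (omega a.1 b.1 c.1).
  by congr pair; rewrite /= ?addr0 // addrC.
have [ST e1 e2] : is_lts S := lts_semidirectP theta.
have [s1 s2 s3] := ST; have [sD1 sD2 sD3] := trilinearD ST.
have SR w a b : S (i w) a b = i (R a.1 b.1 w).
  by congr pair; rewrite /= ?t01 // L1 M1 !add0r.
have SM w a b : S a (i w) b = i (M a.1 b.1 w).
  by congr pair; rewrite /= ?t02 // L2 R1 add0r addr0.
have SL w a b : S a b (i w) = i (L a.1 b.1 w).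
  by congr pair; rewrite /= ?t03 // M2 R2 !addr0.
have twE1 a b c d e : lts_twisted omega (lts_twisted omega a b c) d e
    = S (S a b c) d e + i (R d.1 e.1 (omega a.1 b.1 c.1)
                           + omega (t a.1 b.1 c.1) d.1 e.1).
  by rewrite twE [in S _ _ _]twE sD1 SR iD addrA.
have twE2 a b c d e : lts_twisted omega a (lts_twisted omega b c d) e
    = S a (S b c d) e + i (M a.1 e.1 (omega b.1 c.1 d.1)
                           + omega a.1 (t b.1 c.1 d.1) e.1).
  by rewrite twE [in S _ _ _]twE sD2 SM iD addrA.
have twE3 a b c d e : lts_twisted omega a b (lts_twisted omega c d e)
    = S a b (S c d e) + i (L a.1 b.1 (omega c.1 d.1 e.1)
                           + omega a.1 b.1 (t c.1 d.1 e.1)).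
  by rewrite twE [in S _ _ _]twE sD3 SL iD addrA.
have d1E a b c d e : i (lts_d3_1 omega a.1 b.1 c.1 d.1 e.1)
  = lts_twisted omega a b (lts_twisted omega c d e)
    - (lts_twisted omega (lts_twisted omega a b c) d e
       - lts_twisted omega (lts_twisted omega a b d) c e
       - lts_twisted omega (lts_twisted omega a b e) c d
       + lts_twisted omega (lts_twisted omega a b e) d c).
  rewrite twE3 !twE1 e1 /lts_d3_1 !(iD, iN); zmod_cancel.
have d2E a b c d e : i (lts_d3_2 omega a.1 b.1 c.1 d.1 e.1)
  = lts_twisted omega a (lts_twisted omega b c d) e
    - (lts_twisted omega (lts_twisted omega a b c) d e
       - lts_twisted omega (lts_twisted omega a c b) d e
       - lts_twisted omega (lts_twisted omega a d b) c e
       + lts_twisted omega (lts_twisted omega a d c) b e).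
  rewrite twE2 !twE1 e2 /lts_d3_2 !(iD, iN); zmod_cancel.
split=> [[_ i1 i2] | [_ c1 c2]]; split=> //.
- move=> a b c d e; have := d1E (a, 0) (b, 0) (c, 0) (d, 0) (e, 0).
  by rewrite i1 subrr => /(congr1 snd).
- move=> a b c d e; have := d2E (a, 0) (b, 0) (c, 0) (d, 0) (e, 0).
  by rewrite i2 subrr => /(congr1 snd).
- split=> b c k x y; rewrite !twE ?(s1, s2, s3) /= ?(o1, o2, o3) iD iZ;
    rewrite scalerDr; zmod_cancel.
- by move=> a b c d e; apply/eqP; rewrite -subr_eq0 -d1E c1.
- by move=> a b c d e; apply/eqP; rewrite -subr_eq0 -d2E c2.
Qed.

End LeibnizTripleSystems.

Section DerivedTripleSystem.
Variables (K : fieldType).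

Let linE := (linearDl, linearDr, linearNl, linearNr).

Section Triple.
Variables (U : lmodType K) (A : leibnizAlgebra U).

Definition derived_op (u v w : U) : U := A (A u v) w.

Lemma derived_opP : is_lts derived_op.
Proof.
split.
- by split=> b c a x y; rewrite /derived_op !(linearP, linearPl).
- by move=> a b c d e; rewrite /derived_op !(leib_identity, linE); zmod_cancel.
- by move=> a b c d e; rewrite /derived_op !(leib_identity, linE); zmod_cancel.
Qed.

Definition derived_triple : leibnizTriple U := LeibnizTriple derived_opP.

End Triple.

Section Rep.
Variables (U W : lmodType K) (A : leibnizAlgebra U) (rho : leibnizRep A W).

Definition derived_r (u v : U) (x : W) : W := rep_r rho v (rep_r rho u x).
Definition derived_m (u v : U) (x : W) : W := rep_r rho v (rep_l rho u x).
Definition derived_l (u v : U) (x : W) : W := rep_l rho (A u v) x.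

Definition leib_semidirect (a b : U * W) : U * W :=
  (A a.1 b.1, rep_l rho a.1 b.2 + rep_r rho b.1 a.2).

Lemma leib_semidirect_bilinear : bilinear_for
  (GRing.Scale.Law.clone _ _ *:%R _) (GRing.Scale.Law.clone _ _ *:%R _)
  leib_semidirect.
Proof.
by split=> -[c z] a [x u] [y v]; congr pair => /=;
  rewrite !(linearP, linearPl) ?scalerDr //=; zmod_cancel.
Qed.

HB.instance Definition _ :=
  bilinear_isBilinear.Build K (U * W)%type (U * W)%type (U * W)%type _ _
    leib_semidirect leib_semidirect_bilinear.

Lemma leib_semidirect_identity x y z :
  leib_semidirect x (leib_semidirect y z)
  = leib_semidirect (leib_semidirect x y) z
    - leib_semidirect (leib_semidirect x z) y.
Proof.
case: x y z => [x u] [y v] [z w]; congr pair => /=; first exact: leib_identity.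
rewrite rep_r_r (rep_l_l _ x y) (rep_l_r _ x z) !linE; zmod_cancel.
Qed.

Lemma derived_r_trilinear : trilinear derived_r.
Proof.
by split=> b c a x y; rewrite /derived_r !(linearP, linearPl).
Qed.

Lemma derived_m_trilinear : trilinear derived_m.
Proof.
by split=> b c a x y; rewrite /derived_m !(linearP, linearPl).
Qed.

Lemma derived_l_trilinear : trilinear derived_l.
Proof.
by split=> b c a x y; rewrite /derived_l !(linearP, linearPl).
Qed.

Lemma derived_semidirectP :
  is_lts (lts_semidirect (derived_triple A) derived_r derived_m derived_l).
Proof.
have tE a b c : lts_semidirect (derived_triple A) derived_r derived_m derived_l
    a b c = derived_op (LeibnizAlgebra leib_semidirect_identity) a b c.
  by rewrite /derived_op /lts_semidirect /= /leib_semidirect /= linearD addrA.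
have [[t1 t2 t3] i1 i2] := derived_opP (LeibnizAlgebra leib_semidirect_identity).
split; [split | |].
- by move=> b c k x y; rewrite !tE t1.
- by move=> b c k x y; rewrite !tE t2.
- by move=> b c k x y; rewrite !tE t3.
- by move=> a b c d e; rewrite !tE i1.
- by move=> a b c d e; rewrite !tE i2.
Qed.

Definition derived_rep : ltsRep (derived_triple A) W :=
  LtsRep derived_r_trilinear derived_m_trilinear derived_l_trilinear
    derived_semidirectP.

End Rep.

End DerivedTripleSystem.

(* Main.v *)
Require Import Defs.
From HB Require Import structures.
From mathcomp Require Import all_boot ssralg sesquilinear.

Set Implicit Arguments.
Unset Strict Implicit.
Unset Printing Implicit Defensive.

Import GRing.Theory.
Local Open Scope ring_scope.

(** The statement holds for any Leibniz algebra [A] on [U] with a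
representation on [W]; the Rota-Baxter operator only supplies an instance.

A 2-cocycle [phi] is exactly what makes the semidirect bracket on [U * W],
perturbed by [phi] in its second component, a Leibniz algebra again (an abelian
extension of [A] by [W]). The Leibniz triple system derived from this extension
is the semidirect triple product perturbed by
[omega u v w = phi (A u v) w + rho^r w (phi u v)]. Since 3-cocycles are exactly
the perturbations of the semidirect triple product that give Leibniz triple
systems ([lts_cocycle3P]), [omega] is a 3-cocycle; see [derived_cocycle3].

The map [phi |-> omega] is additive and sends [leib_d1 alpha] to
[lts_d1 alpha], because the two occurrences of [rho^r w (alpha (A u v))] cancel
([derived_cochain_d1]). So the same [alpha] relates the 2-cocycles and the
3-cocycles. *)

Section DerivedCocycle.
Variables (K : fieldType) (U W : lmodType K).
Variables (A : leibnizAlgebra U) (rho : leibnizRep A W).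

Let linE := (linearDl, linearDr, linearNl, linearNr).

Definition derived_cochain (phi : U -> U -> W) (u v w : U) : W :=
  phi (A u v) w + rep_r rho w (phi u v).

Lemma derived_cochain_trilinear (phi : {bilinear U -> U -> W}) :
  trilinear (derived_cochain phi).
Proof.
by split=> b c a x y; rewrite /derived_cochain !(linearP, linearPl) /= scalerDr;
  zmod_cancel.
Qed.

Section Extension.
Variable phi : {bilinear U -> U -> W}.

Definition leib_twisted (a b : U * W) : U * W :=
  (A a.1 b.1, phi a.1 b.1 + (rep_l rho a.1 b.2 + rep_r rho b.1 a.2)).

Lemma leib_twisted_bilinear : bilinear_for
  (GRing.Scale.Law.clone _ _ *:%R _) (GRing.Scale.Law.clone _ _ *:%R _)
  leib_twisted.
Proof.
by split=> -[c z] a [x u] [y v]; congr pair => /=;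
  rewrite !(linearP, linearPl) ?scalerDr //=; zmod_cancel.
Qed.

HB.instance Definition _ :=
  bilinear_isBilinear.Build K (U * W)%type (U * W)%type (U * W)%type _ _
    leib_twisted leib_twisted_bilinear.

(** The part of the identity linear in [phi] is the cocycle equation; the rest
is the identity of the semidirect product. *)
Lemma leib_twisted_identity : leib_cocycle2 rho phi -> forall x y z,
  leib_twisted x (leib_twisted y z)
  = leib_twisted (leib_twisted x y) z - leib_twisted (leib_twisted x z) y.
Proof.
move=> phiP [x u] [y v] [z w]; congr pair => /=; first exact: leib_identity.
apply/eqP; rewrite -subr_eq0 -[X in _ == X](phiP x y z); apply/eqP.
rewrite rep_r_r (rep_l_l _ x y) (rep_l_r _ x z) !linE; zmod_cancel.
Qed.

End Extension.

(** The triple product derived from the abelian extension defined by [phi] is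
the twist by [derived_cochain phi] of the semidirect triple product. *)
Lemma derived_cocycle3 (phi : {bilinear U -> U -> W}) :
  leib_cocycle2 rho phi ->
  lts_cocycle3 (derived_rep rho) (derived_cochain phi).
Proof.
move=> phiP; apply/(lts_cocycle3P _ (derived_cochain_trilinear phi)).
pose E := LeibnizAlgebra (leib_twisted_identity phiP).
have tE a b c : lts_twisted (derived_rep rho) (derived_cochain phi) a b c
    = derived_op E a b c.
  rewrite /derived_op /E /= /leib_twisted /lts_twisted /=; congr pair.
  by rewrite /derived_cochain /derived_l /derived_m /derived_r !linE; zmod_cancel.
have [[t1 t2 t3] i1 i2] := derived_opP E.
split; [split | |].
- by move=> b c k x y; rewrite !tE t1.
- by move=> b c k x y; rewrite !tE t2.
- by move=> b c k x y; rewrite !tE t3.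
- by move=> a b c d e; rewrite !tE i1.
- by move=> a b c d e; rewrite !tE i2.
Qed.

Lemma derived_cochain_d1 (alpha : {linear U -> W}) u v w :
  derived_cochain (leib_d1 rho alpha) u v w
  = lts_d1 (derived_rep rho) alpha u v w.
Proof.
rewrite /derived_cochain /leib_d1 /lts_d1 /= /derived_l /derived_m /derived_r.
rewrite !linE /derived_op; zmod_cancel.
Qed.

Lemma derived_cohomologous3 (phi1 phi2 : {bilinear U -> U -> W}) :
  leib_cohomologous2 rho phi1 phi2 ->
  lts_cohomologous3 (derived_rep rho)
    (derived_cochain phi1) (derived_cochain phi2).
Proof.
case=> c1 c2 [alpha alphaE]; split; [exact: derived_cocycle3..|].
exists alpha => u v w; rewrite -derived_cochain_d1 /derived_cochain.
rewrite -!alphaE !linE; zmod_cancel.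
Qed.

End DerivedCocycle.

Theorem proposition6p10 (K : fieldType) (L V : lmodType K)
    (A : leibnizAlgebra L) (rho : leibnizRep A V) (T : relRotaBaxter rho)
    (phi1 phi2 : {bilinear V -> V -> L}) :
  leib_cocycle2 (rb_rep T) phi1 ->
  leib_cocycle2 (rb_rep T) phi2 ->
  leib_cohomologous2 (rb_rep T) phi1 phi2 ->
  lts_cohomologous3 (derived_rep (rb_rep T))
    (fun u v w => phi1 (rb_bracket T u v) w + rb_rep_r T w (phi1 u v))
    (fun u v w => phi2 (rb_bracket T u v) w + rb_rep_r T w (phi2 u v)).
Proof. by move=> _ _; apply: derived_cohomologous3. Qed.
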